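(* Let $d$ be a positive integer. Let $T$ be the rooted tree with root $r$ that arises from $2^{2d-2}$ disjoint copies of the full binary tree of depth $d-1$ in which all leaves have depth $d-1$ (i.e. every vertex at depth less than $d-1$ has exactly two children and every vertex at depth $d-1$ has no children) by adding the new vertex $r$ and joining $r$ by an edge to the root of each copy. Then $T$ has radius $d$ and $\gamma_e(T)=2^{2d-2}$, where $\gamma_e(T)$ is the exponential domination number of $T$. (Hence the upper bound $\gamma_e(G)\leq 2^{2\,\mathrm{rad}(G)-2}$ for connected graphs $G$ of radius $\mathrm{rad}(G)\ge 1$ is tight for every value of the radius.)
   Context: All graphs are finite, simple, and undirected. Let $G$ be a graph and $S\subseteq V(G)$. For two vertices $u,v$ of $G$ with $u\in S$ or $v\in S$, let $\mathrm{dist}_{(G,S)}(u,v)$ be the minimum number of edges of a path $P$ in $G$ between $u$ and $v$ such that $S$ contains exactly one endvertex of $P$ and no internal vertex of $P$; if no such path exists, $\mathrm{dist}_{(G,S)}(u,v)=\infty$. (Thus $\mathrm{dist}_{(G,S)}(u,u)=0$ for $u\in S$, and $\mathrm{dist}_{(G,S)}(u,v)=\infty$ for distinct $u,v\in S$.) For a vertex $u$ of $G$, let $$w_{(G,S)}(u)=\sum_{v\in S}\left(\tfrac12\right)^{\mathrm{dist}_{(G,S)}(u,v)-1},\qquad \left(\tfrac12\right)^{\infty}=0,$$ so that $w_{(G,S)}(u)=2$ for $u\in S$. The set $S$ is an exponential dominating set of $G$ if $w_{(G,S)}(u)\geq 1$ for every vertex $u$ of $G$. The exponential domination number $\gamma_e(G)$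 is the minimum order of an exponential dominating set of $G$. *)

(* Defs.v *)
From mathcomp Require Import all_boot all_order all_algebra.

Set Implicit Arguments.
Unset Strict Implicit.
Unset Printing Implicit Defensive.

Import Order.TTheory GRing.Theory Num.Theory.

Record graph := Graph {
  vertex :> finType;
  adj : rel vertex;
  adj_sym : symmetric adj;
  adj_irr : irreflexive adj }.

Section Graph.

Variable G : graph.
Implicit Types (u v : G) (S : {set G}).

Definition gpath u (p : seq G) v :=
  [&& path (@adj G) u p, uniq (u :: p) & last u p == v].

Definition connected := forall u v, connect (@adj G) u v.

(* A path has fewer than #|G| edges.  The value is #|G|, which exceeds every
   finite distance, when there is no path between u and v. *)
Definition dist u v : nat :=
  find (fun n => [exists p : n.-tuple G, gpath u p v]) (iota 0 #|G|).

Definition ecc u : nat := \max_(v : G) dist u v.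

(* Since ecc u <= #|G| for all u, the default value #|G| is immaterial. *)
Definition radius : nat := \big[minn/#|G|]_(u : G) ecc u.

(* When u = v the path has a single endvertex, and [set u; v] = [set u]. *)
Definition Spath S u (p : seq G) v :=
  [&& gpath u p v,
      #|S :&: [set u; v]| == 1
    & all (fun x => (x \notin [set u; v]) ==> (x \notin S)) (u :: p)].

(* None stands for infinity; as above, only lengths below #|G| can occur. *)
Definition Sdist S u v : option nat :=
  let n := find (fun n => [exists p : n.-tuple G, Spath S u p v])
                (iota 0 #|G|) in
  if n < #|G| then Some n else None.

(* The exponent is an integer, so that a distance of 0 contributes 2. *)
Definition contrib (o : option nat) : rat :=
  if o is Some n then ((1 / 2%:R) ^ (n%:Z - 1))%R else 0%R.

Definition weight S u : rat := (\sum_(v in S) contrib (Sdist S u v))%R.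

Definition exp_dominating S : bool := [forall u : G, (1 <= weight S u)%R].

(* The vertex set itself is always exponentially dominating: see
   exp_dominating_setT. *)
Definition gamma_e : nat :=
  #|[arg min_(S < [set: G] | exp_dominating S) #|S|]|.

Lemma exp_dominating_setT : exp_dominating [set: G].
Proof.
apply/forallP => u; rewrite /weight (bigD1 u) ?inE //=.
have -> : Sdist [set: G] u u = Some 0.
  have Su : [exists p : 0.-tuple G, Spath [set: G] u p u].
    apply/existsP; exists [tuple].
    by rewrite /Spath /gpath /= eqxx setTI setUid cards1 in_set1 !eqxx.
  have := max_card (pred1 u); rewrite card1 /Sdist.
  by case: #|G| => [|n] //=; rewrite Su.
rewrite -[X in (X <= _)%R]addr0 lerD //.
apply: sumr_ge0 => v _; rewrite /contrib; case: Sdist => [n|] //.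
exact: exprz_ge0.
Qed.

End Graph.

(* The full binary tree of depth k: a vertex at depth j <= k is the bit string
   of length j that records the branches taken from the root. *)
Section BinTree.

Variable k : nat.

Definition child (s t : k.-bseq bool) : bool :=
  [exists b : bool, val t == rcons (val s) b].

Definition bintree_adj (s t : k.-bseq bool) : bool := child s t || child t s.

Lemma bintree_sym : symmetric bintree_adj.
Proof. by move=> s t; rewrite /bintree_adj orbC. Qed.

Lemma bintree_irr : irreflexive bintree_adj.
Proof.
move=> s; rewrite /bintree_adj orbb; apply/existsP => -[b /eqP /(congr1 size)].
by rewrite size_rcons => /n_Sn.
Qed.

Definition bintree : graph := Graph bintree_sym bintree_irr.

Definition bintree_root : bintree := [bseq].

End BinTree.

(* The graph obtained from n disjoint copies of H by adding a new vertex,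
   None, and joining it to the vertex h of each copy. *)
Section JoinCopies.

Variables (n : nat) (H : graph) (h : H).

Definition join_copies_adj (x y : option ('I_n * H)) : bool :=
  match x, y with
  | Some (i, a), Some (j, b) => (i == j) && adj a b
  | None, Some (_, a) | Some (_, a), None => a == h
  | None, None => false
  end.

Lemma join_copies_sym : symmetric join_copies_adj.
Proof. by move=> [[i a]|] [[j b]|] //=; rewrite eq_sym adj_sym. Qed.

Lemma join_copies_irr : irreflexive join_copies_adj.
Proof. by move=> [[i a]|] //=; rewrite adj_irr andbF. Qed.

Definition join_copies : graph := Graph join_copies_sym join_copies_irr.

End JoinCopies.

Definition tight_tree (d : nat) : graph :=
  join_copies (2 ^ (2 * d - 2)) (bintree_root d.-1).

(* Main.v *)
Require Import Defs.
From mathcomp Require Import all_boot all_order all_algebra.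
From mathcomp Require Import lra zify.

(* For a set S and a vertex x, let f(x) and a(x) be the contributions to the
   weight of x of the elements of S below x, respectively elsewhere.  Both are
   at most halved when an edge is crossed, f <= 2, and a vertex of S blocks the
   flow.  Hence a <= 1 is inherited by the children of x, and a dominated
   subtree of height h >= 1 whose root x is in S or has a(x) <= 1 contains at
   least 2^(h-1) elements of S; by induction, 2^h f(x) <= 4 |S below x|.
   If S meets all copies then |S| is at least the number of copies.  Otherwise
   a leaf of a missed copy forces the weight of r to be at least 2^d; since
   every copy contributes f/2 to it, |S| >= 2^(d-2) 2^d unless r is in S, and
   then d = 1.  Conversely, one parent of leaves in each copy (the root of the
   copy if d = 1) gives a dominating set: a vertex outside S that is not a
   child of S is joined to each element of S by a path of length at most 2d-1,
   so its weight is at least 2^(2d-2) (1/2)^(2d-2) = 1. *)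

Set Implicit Arguments.
Unset Strict Implicit.
Unset Printing Implicit Defensive.

Import Order.TTheory GRing.Theory Num.Theory.

Lemma geq_bigmin (I : eqType) (r : seq I) (F : I -> nat) m i :
  i \in r -> \big[minn/m]_(j <- r) F j <= F i.
Proof.
elim: r => // j r IH; rewrite inE big_cons geq_min => /predU1P[->|/IH ->].
  by rewrite leqnn.
by rewrite orbT.
Qed.

(** * Distances, weights and flows in an arbitrary graph *)

Section Paths.

Variable G : graph.
Implicit Types (u v x y : G) (S B : {set G}) (p : seq G).

Lemma find_iota_le (P : pred nat) m n : m < n -> P m -> find P (iota 0 n) <= m.
Proof.
move=> lt_mn Pm; rewrite leqNgt; apply/negP => /(before_find 0).
by rewrite nth_iota // Pm.
Qed.

Lemma gpath_size u p v : gpath u p v -> size p < #|G|.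
Proof. by case/and3P=> _ /card_uniqP /= <- _; apply: max_card. Qed.

Lemma dist_le u p v : gpath u p v -> dist u v <= size p.
Proof.
move=> Pp; apply: find_iota_le (gpath_size Pp) _.
by apply/existsP; exists (in_tuple p).
Qed.

Lemma gpath_shorten u p :
  path (@adj G) u p -> exists2 q, gpath u q (last u p) & size q <= size p.
Proof.
case/shortenP=> q pathq uniqq subq; exists q.
  by apply/and3P; split.
by apply: uniq_leq_size => //; case/andP: uniqq.
Qed.

Lemma dist_le_path u p : path (@adj G) u p -> dist u (last u p) <= size p.
Proof. by move/gpath_shorten=> [q /dist_le]; apply: leq_trans. Qed.

(** Gives lower bounds on distances: a potential that rises by at most one per edge can rise far
    only along a long path. *)
Lemma gpath_lipschitz (f : G -> nat) u p v :
    (forall x y, adj x y -> f y <= (f x).+1) ->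
  gpath u p v -> f v <= f u + size p.
Proof.
move=> lip /and3P[+ _ /eqP <-].
elim: p u => [|y p IH] u /=; first by rewrite addn0.
case/andP=> /lip uy /IH /leq_trans; apply.
by rewrite addnS -addSn leq_add2r.
Qed.

(** The bound [m <= #|G|] covers the default value of [dist] when no path exists. *)
Lemma le_dist u v m :
  m <= #|G| -> (forall p, gpath u p v -> m <= size p) -> m <= dist u v.
Proof.
move=> le_m lb; rewrite /dist.
set s := iota _ _; set P := (fun n => _); case: (boolP (has P s)) => hasP; last first.
  by rewrite hasNfind // size_iota.
have /existsP[p /lb] := nth_find 0 hasP; rewrite size_tuple.
by rewrite nth_iota // -[X in _ < X](size_iota 0) -has_find.
Qed.

Lemma Spath_Sdist S u p v :
  Spath S u p v -> exists2 n, Sdist S u v = Some n & n <= size p.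
Proof.
move=> Sp; have /andP[/gpath_size lt_p _] := Sp.
set n := find (fun n => [exists p : n.-tuple G, Spath S u p v]) (iota 0 #|G|).
have le_n : n <= size p.
  by apply: find_iota_le => //; apply/existsP; exists (in_tuple p).
by exists n => //; rewrite /Sdist -/n (leq_ltn_trans le_n lt_p).
Qed.

Lemma Sdist_Spath S u v n :
  Sdist S u v = Some n -> exists2 p, Spath S u p v & size p = n.
Proof.
rewrite /Sdist; set P := (fun n => _); set m := find _ _.
case: ifP => // lt_m [<-].
have hasP : has P (iota 0 #|G|) by rewrite has_find size_iota.
have /existsP[p Sp] := nth_find 0 hasP; exists p => //.
by rewrite size_tuple -/m nth_iota.
Qed.

Local Open Scope ring_scope.

Lemma contribE n : contrib (Some n) = 2 / 2 ^+ n.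
Proof. by rewrite /contrib div1r expfzDr ?invr_eq0 // exprN1 invrK -exprnP exprVn mulrC. Qed.

Lemma contrib_ge0 o : 0 <= contrib o.
Proof. by case: o => [n|] //; rewrite contribE divr_ge0 ?exprn_ge0. Qed.

Lemma Sdist_mem S u v :
  u \in S -> v \in S -> Sdist S u v = if u == v then Some 0 else None.
Proof.
move=> Su Sv; case: eqP => [<-|ne_uv].
  have Sp : Spath S u [::] u.
    by rewrite /Spath /gpath /= setUid (setIidPr _) ?sub1set // cards1 set11 !eqxx.
  by have [[|n] -> ] := Spath_Sdist Sp.
case E: Sdist => [n|] //; have [p /and3P[_ + _] _] := Sdist_Spath E.
rewrite (setIidPr _) ?subUset ?sub1set ?Su // cards2.
by case: (u =P v) ne_uv.
Qed.

(** The edge from [u] to [y] is the only way into [B], so every admissible path from [u] to [v]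
    begins with it; dropping it leaves an admissible path from [y] that is one edge shorter. *)
Lemma contrib_cross S B u v y :
    u \notin B -> u \notin S -> v \in S -> v \in B ->
    (forall a b, a \notin B -> b \in B -> adj a b -> a = u /\ b = y) ->
  contrib (Sdist S u v) <= contrib (Sdist S y v) / 2.
Proof.
move=> Bu Su Sv Bv crossB.
have ge0 o : 0 <= contrib o / 2 by rewrite divr_ge0 ?contrib_ge0.
case E: (Sdist S u v) => [n|]; last exact: ge0.
have [p] := Sdist_Spath E; case/and3P=> /and3P[pathp uniqp /eqP lastp] _ allp <-.
case: p => [|z q] /= in pathp uniqp lastp allp *; first by rewrite -lastp (negPf Bu) in Bv.
case/andP: pathp => adj_uz pathq.
case/andP: uniqp => Nu_q uniqq.
(* If the first step stayed outside [B], the path could enter [B] later only from [u], which it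
   cannot visit twice. *)
have zy : z = y.
  case: (boolP (z \in B)) => [Bz | Bz]; first by case: (crossB _ _ Bu Bz adj_uz).
  have: v \notin B; last by rewrite Bv.
  rewrite -lastp; move: Nu_q; rewrite inE negb_or => /andP[+ Nuq].
  elim: q z Bz pathq Nuq {adj_uz uniqq lastp allp} => //= t q IH z Bz /andP[zt tq].
  rewrite inE negb_or => /andP[nut nuq] nuz; apply: IH => //.
  apply: contra nuz => Bt; have [-> _] := crossB _ _ Bz Bt zt; exact: eqxx.
subst z; case/and3P: allp => _ ally allq.
have Sq : Spath S y q v.
  (* As [y] differs from [u], it can lie in [S] only as the endvertex [v]. *)
  have Sy : y \in S -> y = v.
    move: ally; rewrite !inE; case: eqP Nu_q => [->|_ _ /=]; rewrite ?mem_head //.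
    by case: eqP => //= _ /negP.
  apply/and3P; split; first by apply/and3P; split=> //; apply/eqP.
    case: (boolP (y \in S)) => [/Sy -> | NSy].
      by rewrite setUid (setIidPr _) ?cards1 ?sub1set.
    rewrite setIUr [S :&: [set y]](_ : _ = set0) ?set0U.
      by rewrite (setIidPr _) ?cards1 ?sub1set.
    by apply/setP=> x; rewrite !inE andbC; case: eqP => // ->; apply: negPf.
  have sub x : x \in y :: q -> (x \notin [set u; v]) ==> (x \notin S).
    by rewrite inE => /predU1P[-> //|/(allP allq)].
  apply/allP => x qx; apply/implyP; rewrite !inE negb_or => /andP[_ nxv].
  apply: (implyP (sub x qx)); rewrite !inE negb_or nxv andbT.
  by apply: contra Nu_q => /eqP <-.
have [m -> le_m] := Spath_Sdist Sq.
rewrite -[leLHS]/(contrib (Some (size q).+1)) !contribE exprS invfM mulrA mulrAC ler_wpM2r ?invr_ge0 //.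
by rewrite ler_wpM2l // lef_pV2 ?posrE ?exprn_gt0 // ler_weXn2l ?ler1n.
Qed.

(* Walks suffice: shortening a walk adds no vertices. *)
Definition reaches S n u v := exists p : seq G,
  [/\ path (@adj G) u p, last u p = v, (size p <= n)%N
    & {in u :: p, forall x, x \in S -> x = v}].

Lemma reaches0 S v : reaches S 0 v v.
Proof. by exists [::]; split=> // x; rewrite inE => /eqP. Qed.

Lemma reaches_step S n u y v :
  adj u y -> (u \in S -> u = v) -> reaches S n y v -> reaches S n.+1 u v.
Proof.
move=> uy Su [p [pathp lastp sizep Sp]]; exists (y :: p); split=> //=.
  by rewrite uy.
by move=> x; rewrite inE => /predU1P[-> //|/Sp].
Qed.

Lemma reaches_contrib S n u v :
  v \in S -> reaches S n u v -> 2 / 2 ^+ n <= contrib (Sdist S u v).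
Proof.
move=> Sv [p0 [/shortenP[p pathp uniqp subp] lastp sizep Sp0]].
have Sp : {in u :: p, forall x, x \in S -> x = v}.
  move=> x; rewrite inE => /predU1P[->|/subp p0x]; apply: Sp0.
    exact: mem_head.
  by rewrite inE p0x orbT.
have /Spath_Sdist[m -> le_m] : Spath S u p v.
  apply/and3P; split; first by apply/and3P; split=> //; apply/eqP.
    have -> : S :&: [set u; v] = [set v]; last by rewrite cards1.
    apply/setP=> x; rewrite !inE; apply/andP/eqP => [[Sx /orP[]/eqP xE] //|->].
      by apply: Sp; rewrite // xE mem_head.
    by rewrite Sv eqxx orbT.
  apply/allP=> x px; rewrite !inE negb_or; apply/implyP => /andP[_].
  by apply: contra => /(Sp _ px) ->.
rewrite contribE ler_wpM2l // lef_pV2 ?posrE ?exprn_gt0 // ler_weXn2l ?ler1n //.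
apply: leq_trans le_m (leq_trans _ sizep).
by apply: uniq_leq_size => //; case/andP: uniqp.
Qed.

(** Membership in [B] enters as a 0/1 factor, so that a partition of [B], stated as an identity of
    indicators, splits the flow by linearity. *)
Definition flow S B u : rat :=
  \sum_(v in S) (v \in B)%:R * contrib (Sdist S u v).

Lemma flow_ge0 S B u : 0 <= flow S B u.
Proof. by apply: sumr_ge0 => v _; rewrite mulr_ge0 ?contrib_ge0. Qed.

Lemma weight_flow S u : weight S u = flow S setT u.
Proof. by apply: eq_bigr => v _; rewrite inE mul1r. Qed.

(** All other elements of [S] are at infinite distance from [u], so only its own contribution 2 can
    remain: [S] blocks the flow. *)
Lemma flow_mem S B u : u \in S -> flow S B u = 2 * (u \in B)%:R.
Proof.
move=> Su; rewrite /flow (bigD1 u) //= Sdist_mem // eqxx contribE divr1 mulrC.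
rewrite big1 ?addr0 // => v /andP[Sv nvu].
by rewrite Sdist_mem // eq_sym (negPf nvu) mulr0.
Qed.

Lemma flow_cross S B u y :
    u \notin B ->
    (forall a b, a \notin B -> b \in B -> adj a b -> a = u /\ b = y) ->
  flow S B u <= flow S B y / 2.
Proof.
move=> Bu crossB; have [Su | NSu] := boolP (u \in S).
  by rewrite flow_mem // (negPf Bu) mulr0 divr_ge0 ?flow_ge0.
rewrite /flow mulr_suml; apply: ler_sum => v Sv.
case: (boolP (v \in B)) => [Bv|_]; last by rewrite !mul0r.
by rewrite !mul1r; apply: contrib_cross Bv crossB.
Qed.

Lemma exp_dominating_neq0 S u : exp_dominating S -> (0 < #|S|)%N.
Proof.
move/forallP/(_ u); rewrite card_gt0; apply: contraL => /eqP ->.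
by rewrite /weight big_set0.
Qed.

Lemma gamma_e_eq m :
    (exists2 S : {set G}, exp_dominating S & #|S| = m) ->
    (forall S : {set G}, exp_dominating S -> (m <= #|S|)%N) ->
  gamma_e G = m.
Proof.
move=> [S domS cardS] lb; rewrite /gamma_e.
case: arg_minnP => [|S' domS' minS']; first exact: exp_dominating_setT.
by apply/eqP; rewrite eqn_leq lb // -cardS minS'.
Qed.

End Paths.

(** * Bit-string coordinates and subtrees of the copies *)

Section Copies.

Variables n k : nat.

Local Notation T := (join_copies n (bintree_root k)).

(** Strings longer than [k] fall back to the root of the copy, hence the bounds [size s <= k]
    below. *)
Definition node (i : 'I_n) (s : seq bool) : T :=
  Some (i, insubd [bseq] s : bintree k).

Definition subtree (i : 'I_n) (s : seq bool) : {set T} :=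
  [set x | if x is Some (j, t) then (i == j) && prefix s (val (t : k.-bseq bool))
           else false].

Definition parent (i : 'I_n) (s : seq bool) : T :=
  if s is b :: s' then node i (belast b s') else None.

Lemma parent_rcons i s b : parent i (rcons s b) = node i s.
Proof. by case: s => [|c s] //=; rewrite belast_rcons. Qed.

Lemma nodeP (x : T) :
  x = None \/ exists i, exists2 s, size s <= k & x = node i s.
Proof.
case: x => [[i t]|]; [right | by left].
exists i, (val (t : k.-bseq bool)); first exact: size_bseq.
by rewrite /node valKd.
Qed.

Lemma None_subtree i s : None \notin subtree i s.
Proof. by rewrite inE. Qed.

Lemma node_subtree i s j t :
  size t <= k -> (node j t \in subtree i s) = (i == j) && prefix s t.
Proof. by move=> szt; rewrite inE /= insubdK. Qed.

Lemma node_eq i s j t :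
  size s <= k -> size t <= k -> (node i s == node j t) = (i == j) && (s == t).
Proof.
move=> szs szt; rewrite /eq_op /= xpair_eqE; congr (_ && _).
by rewrite -val_eqE /= !insubdK.
Qed.

Lemma adj_node i s j t : size s <= k -> size t <= k ->
  adj (node i s) (node j t) =
  (i == j) && ([exists b, t == rcons s b] || [exists b, s == rcons t b]).
Proof. by move=> szs szt; rewrite /= /bintree_adj /child /= !insubdK. Qed.

Lemma adj_None i s : size s <= k -> adj (None : T) (node i s) = (s == [::]).
Proof. by move=> szs; rewrite /= -val_eqE /= insubdK. Qed.

Lemma adj_parent i s : size s <= k -> adj (parent i s) (node i s).
Proof.
case/lastP: s => [|s b] szs; first by rewrite adj_None.
rewrite size_rcons in szs.
rewrite parent_rcons adj_node ?size_rcons // ?(ltnW szs) // eqxx /=.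
by apply/orP; left; apply/existsP; exists b.
Qed.

Lemma prefix_rconsE (s t : seq bool) b :
  prefix s (rcons t b) = (s == rcons t b) || prefix s t.
Proof.
apply/idP/idP => [/prefixP[u]|/predU1P[->|]].
- case/lastP: u => [|u c]; first by rewrite cats0 => ->; rewrite eqxx.
  rewrite -rcons_cat => /rcons_inj[-> _].
  by rewrite prefix_prefix orbT.
- exact: prefix_refl.
- by move/prefix_trans; apply; apply: prefix_rcons.
Qed.

(** An identity of 0/1 numbers, to be summed over [S] for cardinalities and flows; [b] is free so
    that either child can be singled out. *)
Lemma prefix_splitE b (s t : seq bool) :
  (prefix s t : nat) =
  (t == s) + (prefix (rcons s b) t + prefix (rcons s (~~ b)) t).
Proof.
elim: s t => [|c s IH] [|e t] //=; first by case: b e => [] [] //; rewrite prefix0s.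
by rewrite eqseq_cons eq_sym; case: eqP => //= _; apply: IH.
Qed.

(** A rooted subtree hangs on a single edge, which is what [flow_cross] requires. *)
Lemma subtree_cross i s (x y : T) :
    size s <= k -> x \notin subtree i s -> y \in subtree i s -> adj x y ->
  x = parent i s /\ y = node i s.
Proof.
move=> szs; case: (nodeP y) => [->|[j [t szt ->]]].
  by rewrite (negPf (None_subtree _ _)).
rewrite node_subtree // => + /andP[/eqP <- pst].
case: (nodeP x) => [->|[l [u szu ->]]].
  rewrite adj_None // => _ /eqP t0; move: pst; rewrite t0 prefixs0 => /eqP ->.
  by [].
rewrite node_subtree // adj_node // => nsu /andP[/eqP il /orP[]/existsP[b /eqP E]].
all: rewrite -il eqxx /= in nsu *.
  move: pst; rewrite E prefix_rconsE (negPf nsu) orbF.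
  by move/eqP=> ->; rewrite parent_rcons.
by rewrite E prefix_rconsE pst orbT in nsu.
Qed.

Lemma in_subtree_split b i s (x : T) : size s < k ->
  (x \in subtree i s : nat) =
  (x \in [set node i s]) +
    ((x \in subtree i (rcons s b)) + (x \in subtree i (rcons s (~~ b)))).
Proof.
move=> szs; case: (nodeP x) => [->|[j [t szt ->]]]; first by rewrite !inE.
rewrite !node_subtree // inE node_eq ?(ltnW szs) // [j == i]eq_sym.
by case: eqP => //= _; apply: prefix_splitE.
Qed.

Lemma in_subtree_compl b i s (x : T) : size s < k ->
  (x \in ~: subtree i (rcons s b) : nat) =
  (x \in [set node i s]) +
    ((x \in ~: subtree i s) + (x \in subtree i (rcons s (~~ b)))).
Proof.
move=> szs; have := in_subtree_split b i x szs; rewrite ![x \in ~: _]in_setC.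
by do 4!case: (x \in _).
Qed.

Lemma subtree_leaf i s : size s = k -> subtree i s = [set node i s].
Proof.
move=> szs; apply/setP=> x.
case: (nodeP x) => [->|[j [t szt ->]]]; first by rewrite !inE.
rewrite node_subtree // inE node_eq ?szs // [j == i]eq_sym; congr (_ && _).
apply/idP/eqP => [/prefixP[u tE]|->]; last exact: prefix_refl.
move: szt; rewrite tE size_cat szs -[leqRHS]addn0 leq_add2l leqn0.
by move/nilP=> ->; rewrite cats0.
Qed.

Lemma in_copies (x : T) : (x == None) + \sum_(i < n) (x \in subtree i [::]) = 1.
Proof.
case: (nodeP x) => [->|[j [t szt ->]]].
  by rewrite eqxx big1 // => i _; rewrite inE.
rewrite (bigD1 j) //= node_subtree // eqxx prefix0s big1 // => i ne_ij.
by rewrite node_subtree // (negPf ne_ij).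
Qed.

(** * Lower bound on the size of exponential dominating sets *)

Section Domination.

Variable S : {set T}.

Lemma card_setIE (B : {set T}) : #|S :&: B| = \sum_(v in S) (v \in B).
Proof.
rewrite -sum1_card [LHS]big_mkcond [RHS]big_mkcond; apply: eq_bigr => x _.
by rewrite inE; do 2!case: (x \in _).
Qed.

Lemma card_subtree b i s : size s < k ->
  #|S :&: subtree i s| = (node i s \in S) +
    (#|S :&: subtree i (rcons s b)| + #|S :&: subtree i (rcons s (~~ b))|).
Proof.
move=> szs; have -> : (node i s \in S : nat) = #|S :&: [set node i s]|.
  case: (boolP (node i s \in S)) => Sx.
    by rewrite (setIidPr _) ?sub1set // cards1.
  apply/esym/eqP; rewrite cards_eq0; apply/eqP/setP=> x; rewrite !inE andbC.
  by case: eqP => // ->; apply: negPf.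
rewrite !card_setIE -!big_split; apply: eq_bigr => x _.
exact: in_subtree_split.
Qed.

Local Open Scope ring_scope.

Lemma flow_set1 (x : T) : flow S [set x] x = 2 * (x \in S)%:R.
Proof.
have [Sx|NSx] := boolP (x \in S); first by rewrite flow_mem // set11.
rewrite mulr0 /flow big1 // => v Sv; rewrite inE.
by case: eqP Sv NSx => [-> ->|]; rewrite ?mul0r.
Qed.

Lemma flow_split (x : T) (A B C D : {set T}) :
    (forall y : T, (y \in A : nat) = (y \in B) + ((y \in C) + (y \in D)))%N ->
  flow S A x = flow S B x + (flow S C x + flow S D x).
Proof.
move=> ABCD; rewrite /flow -!big_split; apply: eq_bigr => v _.
by rewrite ABCD !natrD !mulrDl.
Qed.

Lemma flow_out i s : (size s <= k)%N ->
  flow S (subtree i s) (parent i s) <= flow S (subtree i s) (node i s) / 2.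
Proof.
move=> szs; apply: flow_cross => [|a b]; last exact: subtree_cross.
case/lastP: s szs => [|s b] szs; first by rewrite inE.
rewrite parent_rcons node_subtree; last by rewrite size_rcons in szs; apply: ltnW.
by apply/negP => /andP[_ /size_prefix]; rewrite size_rcons ltnn.
Qed.

Lemma flow_in i s : (size s <= k)%N ->
  flow S (~: subtree i s) (node i s) <= flow S (~: subtree i s) (parent i s) / 2.
Proof.
move=> szs; apply: flow_cross => [|a b].
  by rewrite in_setC negbK node_subtree // eqxx prefix_refl.
rewrite !in_setC negbK adj_sym => aB bB ab.
by have [] := subtree_cross szs bB aB ab.
Qed.

(** Induction on the height: a vertex in [S] has flow 2, and otherwise each of the two children
    passes on at most half of 2. *)
Lemma flow_subtree_le2 i s : (size s <= k)%N -> flow S (subtree i s) (node i s) <= 2.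
Proof.
move=> szs; have [h] : {h | (size s + h = k)%N} by exists (k - size s)%N; rewrite subnKC.
elim: h s {szs} => [|h IH] s szs.
  rewrite addn0 in szs; rewrite subtree_leaf // flow_set1.
  by case: (_ \in _); rewrite ?mulr1 ?mulr0.
have ltsk : (size s < k)%N by rewrite -szs addnS ltnS leq_addr.
have [Sx|NSx] := boolP (node i s \in S).
  by rewrite flow_mem // node_subtree ?(ltnW ltsk) // eqxx prefix_refl mulr1.
rewrite (flow_split _ (fun y => in_subtree_split true i y ltsk)) flow_set1 (negPf NSx) /=.
have step b : flow S (subtree i (rcons s b)) (node i s) <= 1.
  have szb : (size (rcons s b) <= k)%N by rewrite size_rcons.
  have := flow_out i szb; rewrite parent_rcons.
  have := IH (rcons s b); rewrite size_rcons addSnnS => /(_ szs); lra.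
have := step true; have := step false; rewrite /=; lra.
Qed.

(** The child receives half of what reaches its parent from the rest of the tree. This is at most 2:
    exactly 0 or 2 if the parent is in [S], else at most 1 from outside the subtree plus at most 1
    from the sibling. *)
Lemma flow_in_le1 i s b : (size s < k)%N ->
    node i s \in S \/ flow S (~: subtree i s) (node i s) <= 1 ->
  flow S (~: subtree i (rcons s b)) (node i (rcons s b)) <= 1.
Proof.
move=> ltsk hyp.
have szb c : (size (rcons s c) <= k)%N by rewrite size_rcons.
apply: le_trans (flow_in i (szb b)) _; rewrite parent_rcons.
have [Sx|NSx] := boolP (node i s \in S).
  by rewrite flow_mem //; case: (_ \in _); rewrite ?mulr1 ?mulr0.
case: hyp => [Sx|in_s]; first by rewrite Sx in NSx.
rewrite (flow_split _ (fun y => in_subtree_compl b i y ltsk)) flow_set1 (negPf NSx) /=.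
have := flow_out i (szb (~~ b)); rewrite parent_rcons.
have := flow_subtree_le2 i (szb (~~ b)); lra.
Qed.

Hypothesis domS : exp_dominating S.

Lemma weight_subtree i s x : weight S x = flow S (subtree i s) x + flow S (~: subtree i s) x.
Proof.
rewrite weight_flow /flow -big_split; apply: eq_bigr => v _.
by rewrite in_setT in_setC; case: (v \in subtree i s); rewrite /= ?mul1r ?mul0r ?addr0 ?add0r.
Qed.

(** Both children inherit the second alternative by [flow_in_le1], so the count doubles with each
    level; the base case is a vertex with two leaf children. *)
Lemma card_dominated_subtree h i s : (size s + h.+1 = k)%N ->
    node i s \in S \/ flow S (~: subtree i s) (node i s) <= 1 ->
  (2 ^ h <= #|S :&: subtree i s|)%N.
Proof.
elim: h s => [|h IH] s szs hyp.
all: have ltsk : (size s < k)%N by rewrite -szs addnS ltnS leq_addr.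
all: have szb c : (size (rcons s c) <= k)%N by rewrite size_rcons.
  rewrite card_gt0; apply/eqP => S0.
  have NSx x : x \in subtree i s -> x \notin S.
    by move=> Bx; apply/negP => Sx; move/setP/(_ x): S0; rewrite in_setI Sx Bx inE.
  have flow0 b x : flow S (subtree i (rcons s b)) x = 0.
    rewrite /flow big1 // => v Sv; have := in_subtree_split b i v ltsk.
    case: (boolP (v \in subtree i s)) => [/NSx|_]; first by rewrite Sv.
    by case: (v \in subtree _ (rcons s b)); rewrite ?mul0r // addnC.
  have NSs : node i s \notin S.
    by apply: NSx; rewrite node_subtree ?(ltnW ltsk) // eqxx prefix_refl.
  case: hyp => [Ss|in_s]; first by rewrite Ss in NSs.
  (* With [S] missing the subtree, this leaf gets nothing from itself or its sibling, so its weight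
     is at most 1/2. *)
  have := forallP domS (node i (rcons s true)).
  rewrite (weight_subtree i (rcons s true)) flow0 add0r.
  have := flow_in i (szb true); rewrite parent_rcons.
  rewrite (flow_split (node i s) (fun y => in_subtree_compl true i y ltsk)) flow_set1 (negPf NSs) /=.
  rewrite flow0; lra.
have lb b : (2 ^ h <= #|S :&: subtree i (rcons s b)|)%N.
  by apply: IH; [rewrite size_rcons addSnnS | right; apply: flow_in_le1].
rewrite (card_subtree true) // expnS mul2n -addnn.
by apply: leq_trans (leq_addl _ _); apply: leq_add.
Qed.

(** If the root is in [S], its flow is 2 and [card_dominated_subtree] supplies enough elements.
    Otherwise the children's bounds add up, the halved flow compensating the doubled power of 2. *)
Lemma flow_subtree_card h i s : (size s + h = k)%N ->
  2 ^+ h * flow S (subtree i s) (node i s) <= 4 * #|S :&: subtree i s|%:R.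
Proof.
elim: h s => [|h IH] s szs.
  rewrite addn0 in szs; rewrite subtree_leaf // flow_set1 expr0 mul1r card_setIE.
  rewrite (eq_bigr (fun v => (v == node i s : nat))) => [|v _]; last by rewrite inE.
  have [Sx|_] := boolP (node i s \in S); last by rewrite mulr0 mulr_ge0.
  rewrite (bigD1 (node i s)) //= eqxx natrD.
  rewrite /=; have := ler0n rat (\sum_(v in S | v != node i s) (v == node i s)); lra.
have ltsk : (size s < k)%N by rewrite -szs addnS ltnS leq_addr.
have szb c : (size (rcons s c) <= k)%N by rewrite size_rcons.
have [Sx|NSx] := boolP (node i s \in S).
  rewrite flow_mem // node_subtree ?(ltnW ltsk) // eqxx prefix_refl.
  have := card_dominated_subtree szs (or_introl Sx).
  rewrite -(ler_nat rat) natrX exprS /=; lra.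
rewrite (flow_split _ (fun y => in_subtree_split true i y ltsk)) flow_set1 (negPf NSx) /=.
rewrite (card_subtree true) // (negPf NSx) !natrD.
have step b : 2 ^+ h.+1 * flow S (subtree i (rcons s b)) (node i s)
    <= 4 * #|S :&: subtree i (rcons s b)|%:R.
  have := IH (rcons s b); rewrite size_rcons addSnnS => /(_ szs); apply: le_trans.
  have := flow_out i (szb b); rewrite parent_rcons exprS.
  have : 0 < 2 ^+ h :> rat by rewrite exprn_gt0.
  nra.
have := step true; have := step false; rewrite /=; lra.
Qed.

(** In a copy without elements of [S] all weight comes from above and is at least halved on every
    edge down from [None]. *)
Lemma weight_missed_copy i s : (size s <= k)%N ->
  S :&: subtree i [::] = set0 -> 2 ^+ (size s).+1 * weight S (node i s) <= weight S None.
Proof.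
move=> + S0.
have step t : (size t <= k)%N -> 2 * weight S (node i t) <= weight S (parent i t).
  move=> szt; rewrite (weight_subtree i t (node i t)) (weight_subtree i t (parent i t)).
  rewrite [flow S (subtree i t) (node i t)]big1 => [|v Sv].
    have := flow_in i szt; have := flow_ge0 S (subtree i t) (parent i t); lra.
  case: (boolP (v \in subtree i t)) => [|_]; last by rewrite mul0r.
  move/setP/(_ v): S0; rewrite in_setI Sv !inE.
  by case: v {Sv} => [[j u]|] //=; rewrite prefix0s andbT => ->.
elim/last_ind: s => [|s b IH] szs; first exact: step.
have st := step _ szs; rewrite parent_rcons in st; rewrite size_rcons in szs *.
apply: le_trans (IH (ltnW szs)).
by rewrite exprSr -mulrA ler_wpM2l // exprn_ge0.
Qed.

Lemma weight_None : None \notin S ->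
  weight S None = \sum_(i < n) flow S (subtree i [::]) None.
Proof.
move=> NS; rewrite /flow exchange_big; apply: eq_bigr => v Sv.
rewrite -mulr_suml -natr_sum; have := in_copies v.
by case: eqP Sv NS => [-> ->//| _ _ _]; rewrite add0n => ->; rewrite mul1r.
Qed.

End Domination.

Lemma card_copies (S : {set T}) : \sum_(i < n) #|S :&: subtree i [::]| <= #|S|.
Proof.
rewrite (eq_bigr _ (fun i _ => card_setIE S (subtree i [::]))) exchange_big /=.
rewrite -sum1_card; apply: leq_sum => x _; rewrite -(in_copies x); exact: leq_addl.
Qed.

Lemma exp_dominating_card (S : {set T}) :
  exp_dominating S -> minn n (4 ^ k) <= #|S|.
Proof.
move=> domS.
have [all_hit|] := boolP [forall i : 'I_n, S :&: subtree i [::] != set0].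
  apply: leq_trans (geq_minl _ _) (leq_trans _ (card_copies S)).
  rewrite -[X in X <= _]card_ord -sum1_card; apply: leq_sum => i _.
  by rewrite card_gt0 (forallP all_hit).
rewrite negb_forall => /existsP[i]; rewrite negbK => /eqP S0.
apply: leq_trans (geq_minr _ _) _.
(* The string of a deepest leaf in the missed copy [i]. *)
have szk : size (nseq k true) = k by rewrite size_nseq.
have := weight_missed_copy (eq_leq szk) S0; rewrite szk.
(* If [None] is in [S], its weight is 2, so [2 ^ k.+1 <= 2] and [k = 0]; then a nonempty [S] is
   enough. *)
have [SN|NS] := boolP (None \in S).
  rewrite [weight S None]weight_flow (flow_mem _ SN) in_setT mulr1 => le2.
  have : (2 ^+ k.+1 <= 2 :> rat)%R.
    by apply: le_trans le2; rewrite ler_peMr ?exprn_ge0 //; apply: (forallP domS).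
  rewrite -[X in (_ <= X)%R]expr1 ler_eXn2l ?ltr1n // ltnS leqn0 => /eqP k0.
  have -> : 4 ^ k = 1 by rewrite k0.
  exact: (exp_dominating_neq0 (None : T) domS).
rewrite weight_None // => le_w.
rewrite -(leq_pmul2l (isT : 0 < 2)) -(ler_nat rat) !natrM natrX.
have w1 := forallP domS (node i (nseq k true)).
have p_gt0 : (0 < 2 ^+ k :> rat)%R by rewrite exprn_gt0.
have le1 : (2 ^+ k.+1 <= \sum_(i < n) flow S (subtree i [::]) None)%R.
  by apply: le_trans le_w; rewrite ler_peMr ?exprn_ge0.
(* The edge from a copy to [None] turns the factor 4 of [flow_subtree_card] into 2. *)
have le2 : (2 ^+ k * \sum_(i < n) flow S (subtree i [::]) None
    <= 2 * (\sum_(i < n) #|S :&: subtree i [::]|)%:R)%R.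
  rewrite natr_sum !mulr_sumr; apply: ler_sum => j _.
  have := flow_subtree_card domS j (erefl : size [::] + k = k)%N.
  have := flow_out S j (isT : size [::] <= k); rewrite /=; nra.
have := card_copies S; rewrite -(ler_nat rat) => le3.
(* [le1] times [2 ^ k], chained with [le2] and [le3], gives [2 * 4 ^ k <= 2 * #|S|]. *)
have -> : (4%:R ^+ k = 2 ^+ k * 2 ^+ k :> rat)%R by rewrite -exprMn -natrM.
rewrite exprS in le1; nra.
Qed.

(** * A dominating set with one vertex per copy *)

Definition leftmost j : T := node j (nseq k.-1 false).

Definition leftmost_set : {set T} := [set leftmost j | j : 'I_n].

Lemma card_leftmost_set : #|leftmost_set| = n.
Proof.
rewrite card_imset ?card_ord // => i j /eqP.
by rewrite node_eq ?size_nseq ?leq_pred // => /andP[/eqP].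
Qed.

Lemma node_leftmost_set i s :
  size s <= k -> (node i s \in leftmost_set) = (s == nseq k.-1 false).
Proof.
move=> szs; apply/imsetP/eqP => [[j _ /eqP]|->]; last by exists i.
by rewrite node_eq ?size_nseq ?leq_pred // => /andP[_ /eqP].
Qed.

Lemma None_leftmost_set : None \notin leftmost_set.
Proof. by apply/imsetP => -[]. Qed.

Lemma reaches_leftmost_down j m : m <= k.-1 ->
  reaches leftmost_set m (node j (nseq (k.-1 - m) false)) (leftmost j).
Proof.
have le_k : k.-1 <= k by apply: leq_pred.
elim: m => [|m IH] lt_m; first by rewrite subn0; apply: reaches0.
have E : (nseq (k.-1 - m) false) = rcons (nseq (k.-1 - m.+1) false) false.
  by rewrite -cats1 -[[:: false]]/(nseq 1 false) -nseqD addn1 subnSK.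
have szm : size (nseq (k.-1 - m) false) <= k.
  by rewrite size_nseq (leq_trans (leq_subr _ _)).
apply: reaches_step (IH (ltnW lt_m)).
  by have := adj_parent j szm; rewrite {1}E parent_rcons.
rewrite node_leftmost_set ?size_nseq ?(leq_trans (leq_subr _ _)) //.
by move/eqP/(congr1 size); rewrite !size_nseq; lia.
Qed.

Lemma reaches_leftmost_None j : reaches leftmost_set k.-1.+1 None (leftmost j).
Proof.
have := reaches_leftmost_down j (leqnn k.-1); rewrite subnn.
apply: reaches_step; first by rewrite adj_None.
by move=> SN; have := None_leftmost_set; rewrite SN.
Qed.

(** The walk climbs to [None] and descends into copy [j]. The prefix condition passes to all
    ancestors, so the climb avoids the set. *)
Lemma reaches_leftmost_up i s j : size s <= k -> ~~ prefix (nseq k.-1 false) s ->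
  reaches leftmost_set ((size s).+1 + k.-1.+1) (node i s) (leftmost j).
Proof.
elim/last_ind: s => [|s b IH] szs npre.
  apply: reaches_step (reaches_leftmost_None j).
    by rewrite adj_sym adj_None.
  by rewrite node_leftmost_set // => /eqP E; rewrite -E prefix_refl in npre.
have szs' : size s <= k by rewrite size_rcons in szs; apply: ltnW.
rewrite size_rcons addSn.
have : ~~ prefix (nseq k.-1 false) s.
  by apply: contra npre => /prefix_trans; apply; apply: prefix_rcons.
move/(IH szs'); apply: reaches_step.
  by have := adj_parent i szs; rewrite parent_rcons adj_sym.
by rewrite node_leftmost_set // => /eqP E; rewrite -E prefix_refl in npre.
Qed.

Lemma weight_reaches_all m (u : T) :
    (forall j, reaches leftmost_set m u (leftmost j)) ->
  (n%:R * (2 / 2 ^+ m) <= weight leftmost_set u)%R.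
Proof.
move=> reach_u; rewrite -[in X in (X <= _)%R]card_leftmost_set mulr_natl -sumr_const.
apply: ler_sum => v Sv; apply: reaches_contrib => //.
by case/imsetP: Sv => j _ ->.
Qed.

Lemma weight_reaches (S : {set T}) m (u v : T) :
  v \in S -> reaches S m u v -> (2 / 2 ^+ m <= weight S u)%R.
Proof.
move=> Sv /(reaches_contrib Sv) le_c; rewrite /weight (bigD1 v) //=.
by rewrite (le_trans le_c) // lerDl sumr_ge0 // => w _; apply: contrib_ge0.
Qed.

Lemma exp_dominating_leftmost_set :
  4 ^ k <= n -> exp_dominating leftmost_set.
Proof.
move=> le_n; apply/forallP => u.
(* The threshold comes from [2 ^ (2k + 1) = 2 * 4 ^ k <= 2 * n]. *)
have enough m : m <= k.*2.+1 -> (1 <= n%:R * (2 / 2 ^+ m) :> rat)%R.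
  move=> le_m; rewrite mulrA ler_pdivlMr ?exprn_gt0 // mul1r.
  apply: le_trans (_ : 2 ^+ k.*2.+1 <= _)%R; first by rewrite ler_weXn2l ?ler1n.
  rewrite exprSr ler_wpM2r // -mul2n exprM -!natrX ler_nat; exact: le_n.
case: (nodeP u) => [->|[i [s szs ->]]].
  apply: le_trans (weight_reaches_all reaches_leftmost_None); apply: enough.
  by rewrite ltnS -addnn (leq_trans (leq_pred k)) ?leq_addr.
(* Since [size s <= k], the prefix holds only for an element of the set or a child of one. *)
have [/prefixP[t sE]|npre] := boolP (prefix (nseq k.-1 false) s); last first.
  apply: le_trans (weight_reaches_all (fun j => reaches_leftmost_up i j szs npre)).
  (* For [k = 0] the prefix is empty, a contradiction; for [k > 0] the walk has at most
     [(k + 1) + k] edges. *)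
  have [k0|k_gt0] := posnP k.
    by rewrite k0 prefix0s in npre.
  by apply: enough; rewrite prednK // addSn ltnS -addnn leq_add2r.
have Si : leftmost i \in leftmost_set by apply/imsetP; exists i.
have reach1 : reaches leftmost_set 1 (node i s) (leftmost i).
  case: t sE => [|b t] sE; first by rewrite sE cats0; exists [::]; split=> // x /[!inE] /eqP.
  have [t0 k_gt0] : t = [::] /\ 0 < k.
    by move: szs; rewrite sE size_cat size_nseq /=; case: t {sE} => [|? ?] /= ?; [split=> //|]; lia.
  rewrite sE t0 cats1; rewrite sE t0 cats1 in szs.
  apply: reaches_step (reaches0 _ _).
    by have := adj_parent i szs; rewrite parent_rcons adj_sym.
  rewrite node_leftmost_set // => /eqP/(congr1 size)/eqP.
  by rewrite size_rcons -[X in _ == X]addn0 -addn1 eqn_add2l.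
by have := weight_reaches Si reach1; rewrite expr1 divff.
Qed.

(** * Connectedness and radius *)

Lemma path_root i s : size s <= k -> exists p,
  [/\ path (@adj T) None p, last None p = node i s & size p = (size s).+1].
Proof.
elim/last_ind: s => [|s b IH] szs; first by exists [:: node i [::]]; split=> //; apply/andP; rewrite adj_None.
have szs' : size s <= k by rewrite size_rcons in szs; apply: ltnW.
have [p [pathp lastp sizep]] := IH szs'; exists (rcons p (node i (rcons s b))).
rewrite rcons_path pathp lastp last_rcons !size_rcons sizep andTb; split=> //.
by have := adj_parent i szs; rewrite parent_rcons.
Qed.

Lemma join_copies_connected : connected T.
Proof.
have conn x : connect (@adj T) None x.
  case: (nodeP x) => [->|[i [s /(path_root i)[p [pathp lastp _]] ->]]]; first exact: connect0.
  by apply/connectP; exists p.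
by move=> u v; rewrite (connect_trans _ (conn v)) // (sym_connect_sym (@adj_sym T)).
Qed.

Definition depth (x : T) : nat :=
  if x is Some (_, s) then (size (val (s : k.-bseq bool))).+1 else 0.

Lemma depth_node i s : size s <= k -> depth (node i s) = (size s).+1.
Proof. by move=> szs; rewrite /= insubdK. Qed.

(* The depth taken with a negative sign on copy i, shifted by k.+1 to stay in
   nat. *)
Definition signed_depth (i : 'I_n) (x : T) : nat :=
  if x \in subtree i [::] then k.+1 - depth x else k.+1 + depth x.

Lemma depth_lipschitz (x y : T) : adj x y -> depth y <= (depth x).+1.
Proof.
case: x y => [[i s]|] [[j t]|] //=; last by move=> /eqP ->.
case/andP=> _ /orP[]/existsP[b /eqP] /= ->; rewrite size_rcons //.
by rewrite ltnS leqW.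
Qed.

Lemma signed_depth_lipschitz i (x y : T) :
  adj x y -> signed_depth i y <= (signed_depth i x).+1.
Proof.
move=> xy; have := depth_lipschitz xy; have yx := xy; rewrite adj_sym in yx.
have := depth_lipschitz yx; rewrite /signed_depth.
case: ifP => [By|/negbT By]; case: ifP => [Bx|/negbT Bx]; try by lia.
(* Copy [i] is left or entered only between its root, of value [k], and [None], of value [k.+1]. *)
by have [-> ->] := subtree_cross (isT : size [::] <= k) By Bx yx; rewrite depth_node //=; lia.
Qed.

(** A path from [None] to a deepest leaf has at least [k.+1] edges. The bound controls the default
    value [#|T|] in [dist] and [radius]. *)
Lemma card_join_copies : 0 < n -> k.+1 < #|T|.
Proof.
move=> n_gt0; have szk : size (nseq k true) = k by rewrite size_nseq.
have [p [pathp lastp _]] := path_root (Ordinal n_gt0) (eq_leq szk).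
have [q gpq _] := gpath_shorten pathp.
apply: leq_ltn_trans (gpath_size gpq).
by have := gpath_lipschitz depth_lipschitz gpq; rewrite lastp depth_node ?szk.
Qed.

Lemma ecc_ge (u : T) : 0 < n -> (0 < k -> 1 < n) -> k.+1 <= ecc u.
Proof.
move=> n_gt0 n_gt1; have szk : size (nseq k true) = k by rewrite size_nseq.
have far v : (forall p, gpath u p v -> k.+1 <= size p) -> k.+1 <= ecc u.
  move=> lb; apply: leq_trans (leq_bigmax v); apply: le_dist => //.
  exact: ltnW (card_join_copies n_gt0).
case: (nodeP u) => [uE|[i [s szs uE]]].
  apply: (far (node (Ordinal n_gt0) (nseq k true))) => p /(gpath_lipschitz depth_lipschitz).
  by rewrite uE depth_node ?szk.
(* For [k = 0] there may be only one copy, so [None] serves as the far vertex, with reversed depth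
   as potential. *)
have [k0|k_gt0] := posnP k.
  apply: (far None) => p.
  have lip (x y : T) : adj x y -> k.+1 - depth y <= (k.+1 - depth x).+1.
    by rewrite adj_sym => /depth_lipschitz; lia.
  by move/(gpath_lipschitz lip); rewrite uE depth_node //=; lia.
have [j ne_ij] : exists j, i != j.
  have [i0|] := eqVneq i (Ordinal n_gt0); last by exists (Ordinal n_gt0).
  by exists (Ordinal (n_gt1 k_gt0)); rewrite i0.
(* From [u] to a deepest leaf of another copy the potential rises by [k.+1] plus the depth of
   [u]. *)
apply: (far (node j (nseq k true))) => p /(gpath_lipschitz (signed_depth_lipschitz i)).
rewrite uE /signed_depth !node_subtree ?szk // eqxx (negPf ne_ij) !prefix0s.
by rewrite !depth_node ?szk //=; lia.
Qed.

Lemma ecc_root : ecc (None : T) <= k.+1.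
Proof.
apply/bigmax_leqP => x _; case: (nodeP x) => [->|[i [s szs ->]]].
  by apply: leq_trans (dist_le_path (isT : path (@adj T) None [::])) _.
have [p [pathp <- sizep]] := path_root i szs.
by apply: leq_trans (dist_le_path pathp) _; rewrite sizep.
Qed.

Lemma radius_join_copies : 0 < n -> (0 < k -> 1 < n) -> radius T = k.+1.
Proof.
move=> n_gt0 n_gt1; apply/eqP; rewrite eqn_leq; apply/andP; split.
  by apply: leq_trans ecc_root; apply: geq_bigmin; rewrite mem_index_enum.
apply: (big_ind (fun m => k.+1 <= m)) => [|a b|u _]; last exact: ecc_ge.
  exact: ltnW (card_join_copies n_gt0).
by rewrite leq_min => -> ->.
Qed.

Lemma gamma_e_join_copies : n = 4 ^ k -> gamma_e T = n.
Proof.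
move=> nE; apply: gamma_e_eq => [|S /exp_dominating_card]; last by rewrite -nE minnn.
exists leftmost_set; last exact: card_leftmost_set.
by apply: exp_dominating_leftmost_set; rewrite -nE.
Qed.

End Copies.

Theorem mainTheorem4 (d : nat) (hd : 0 < d) :
  [/\ connected (tight_tree d),
      radius (tight_tree d) = d
    & gamma_e (tight_tree d) = 2 ^ (2 * d - 2)].
Proof.
(* With [k = d.-1], the number of copies is the value [4 ^ k] at which lower and upper bound
   meet. *)
have nE : 2 ^ (2 * d - 2) = 4 ^ d.-1.
  by rewrite -[4]/(2 ^ 2) -expnM; congr (2 ^ _); lia.
split; first exact: join_copies_connected.
  rewrite -[RHS](prednK hd); apply: radius_join_copies; rewrite nE ?expn_gt0 //.
  by move=> d_gt1; rewrite -[1](exp1n d.-1) ltn_exp2r.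
exact: gamma_e_join_copies.
Qed.
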